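(* Let $E$ be a Banach function space with the semi-Fatou property and let $k\in\mathbb N$, $k\ge2$. If $x\in E^+$ is a point of compact local fully $k$-rotundity of $E$, then $x$ is a point of order continuity of $E$.
   Context: Let $I=[0,\alpha)$, $\alpha=1$ or $\alpha=\infty$, with Lebesgue measure, and $L^0$ the set of (classes of) extended real valued measurable functions on $I$. A Banach function space $(E,\|\cdot\|_E)$ is a Banach lattice that is a sublattice of $L^0$ such that (1) if $x\in L^0$, $y\in E$, $|x|\le|y|$ a.e., then $x\in E$ and $\|x\|_E\le\|y\|_E$; (2) there is a strictly positive $x\in E$. $E^+=\{x\in E:x\ge0\}$; $S_E$ is the unit sphere. Semi-Fatou property: if $(x_n)\subset E^+$ and $x_n\uparrow x\in E^+$, then $\|x_n\|_E\uparrow\|x\|_E$. A point $x\in S_E$ is a point of compact local fully $k$-rotundity if every sequence $(x_n)\subset S_E$ such that $\|x+\sum_{i=1}^k x_{n,i}\|_E\to k+1$ as $n\to\infty$ for any $k$ subsequences $(x_{n,1})_n,\dots,(x_{n,k})_n$ of $(x_n)$ forms a relatively compact set. A point $x\in E$ is a point of order continuity if for any sequence $(x_n)\subset E^+$ with $x_n\le|x|$ and $x_n\to0$ a.e. one has $\|x_n\|_E\to0$. *)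

(* Defs.v *)
From HB Require Import structures.
From mathcomp Require Import all_boot all_order all_algebra.
From mathcomp Require Import all_classical all_reals all_analysis measurable_realfun.

Set Implicit Arguments.
Unset Strict Implicit.
Unset Printing Implicit Defensive.

Import Order.TTheory GRing.Theory Num.Theory.
Import numFieldNormedType.Exports.

Local Open Scope classical_set_scope.
Local Open Scope ring_scope.

Definition domI (R : realType) (alpha : \bar R) : set R :=
  [set t | 0 <= t /\ (t%:E < alpha)%E].

(* "P holds for almost every t in [0, alpha)". *)
Definition aeI (R : realType) (alpha : \bar R) (P : R -> Prop) : Prop :=
  {ae (@lebesgue_measure R), forall t, domI alpha t -> P t}.

(* An element of L^0 is represented by a function R -> \bar R that is
   measurable on [0, alpha); only its class modulo a.e. equality on [0, alpha)
   matters. A Banach function space is a real Banach space together with an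
   embedding [bfs_fun] in L^0 ([bfs_fun_inj] is injectivity on classes) that
   identifies it with a sublattice and linear subspace of L^0. The linearity
   conditions force the represented functions to be finite a.e., so that the
   value given to oo - oo is irrelevant. The order is that of L^0, and
   [bfs_ideal] contains the monotonicity of a lattice norm. *)
Record banach_function_space (R : realType) (alpha : \bar R) := BFS {
  bfs_sort :> completeNormedModType R ;
  bfs_fun : bfs_sort -> R -> \bar R ;
  bfs_measurable : forall x, measurable_fun (domI alpha) (bfs_fun x) ;
  bfs_fun_inj : forall x y,
    aeI alpha (fun t => bfs_fun x t = bfs_fun y t) -> x = y ;
  bfs_funD : forall x y,
    aeI alpha (fun t => bfs_fun (x + y) t = (bfs_fun x t + bfs_fun y t)%E) ;
  bfs_funZ : forall (a : R) x,
    aeI alpha (fun t => bfs_fun (a *: x) t = (a%:E * bfs_fun x t)%E) ;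
  bfs_max : forall x y, exists z,
    aeI alpha (fun t => bfs_fun z t = maxe (bfs_fun x t) (bfs_fun y t)) ;
  bfs_min : forall x y, exists z,
    aeI alpha (fun t => bfs_fun z t = mine (bfs_fun x t) (bfs_fun y t)) ;
  bfs_ideal : forall (f : R -> \bar R) y,
    measurable_fun (domI alpha) f ->
    aeI alpha (fun t => (`|f t| <= `|bfs_fun y t|)%E) ->
    exists2 x, aeI alpha (fun t => bfs_fun x t = f t) & `|x| <= `|y| ;
  bfs_weak_unit : exists x, aeI alpha (fun t => (0 < bfs_fun x t)%E) }.

Arguments bfs_fun {R alpha} b x t.

Section Notions.
Context {R : realType} {alpha : \bar R}.
Variable E : banach_function_space alpha.

Definition positive_cone : set E :=
  [set x | aeI alpha (fun t => (0 <= bfs_fun E x t)%E)].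

Definition unit_sphere : set E := [set x | `|x| = 1].

Definition increases_to (u : nat -> E) (x : E) : Prop :=
  (forall n, aeI alpha (fun t => (bfs_fun E (u n) t <= bfs_fun E (u n.+1) t)%E))
  /\ aeI alpha (fun t => bfs_fun E (u n) t @[n --> \oo] --> bfs_fun E x t).

Definition semi_Fatou : Prop :=
  forall (u : nat -> E) (x : E),
    (forall n, positive_cone (u n)) -> positive_cone x -> increases_to u x ->
    nondecreasing_seq (fun n => `|u n|) /\ `|u n| @[n --> \oo] --> `|x|.

(* [phi i] enumerates the indices of the i-th subsequence of [u]. *)
Definition compact_local_fully_rotund (k : nat) (x : E) : Prop :=
  unit_sphere x /\
  forall u : nat -> E,
    (forall n, unit_sphere (u n)) ->
    (forall phi : 'I_k -> nat -> nat,
       (forall i, increasing_seq (phi i)) ->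
       `|x + \sum_(i < k) u (phi i n)| @[n --> \oo] --> (k.+1%:R : R)) ->
    precompact (range u).

Definition order_continuity_point (x : E) : Prop :=
  forall u : nat -> E,
    (forall n, positive_cone (u n)) ->
    (forall n, aeI alpha (fun t => (bfs_fun E (u n) t <= `|bfs_fun E x t|)%E)) ->
    aeI alpha (fun t => bfs_fun E (u n) t @[n --> \oo] --> (0 : \bar R)) ->
    `|u n| @[n --> \oo] --> (0 : R).

End Notions.

(* Main.v *)
(** If [0 <= u n <= x] and [u n] tends to 0 a.e., then the tail suprema [v n]
    decrease to 0 a.e., so [s n := x - v n] increases to [x] and the norms of
    the [s n] tend to 1 by the semi-Fatou property. Normalising [s n] to [w n],
    which only increases it, every sum of [x] with [k] terms of [w] of index at
    least [n] dominates [(k+1) s n], so its norm tends to [k+1]; rotundity then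
    makes [w], hence [s], accumulate in norm at some [y]. As the cone is closed,
    [y] dominates every [s n], hence [x], so that [0 <= v n <= y - s n], which
    is small for some [n] and therefore for all larger ones. *)
Require Import Defs.
From mathcomp Require Import all_boot all_order all_algebra.
From mathcomp Require Import all_classical all_reals all_analysis.
From mathcomp Require Import measurable_realfun lra.

Set Implicit Arguments.
Unset Strict Implicit.
Unset Printing Implicit Defensive.

Import Order.TTheory GRing.Theory Num.Theory.
Import numFieldNormedType.Exports.

Local Open Scope classical_set_scope.
Local Open Scope ring_scope.

(** * Almost everywhere statements on [[0, alpha)] as a filter *)

Section AlmostEverywhere.
Context {R : realType} (alpha : \bar R).

Global Instance aeI_filter : Filter (aeI alpha).
Proof.
have aeF : Filter (almost_everywhere (@lebesgue_measure R)).
  exact: (@ae_filter_ringOfSetsType _ (measurableTypeR R)).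
split.
- by rewrite /aeI; apply: filterS filterT => t _ _.
- rewrite /aeI => P Q; apply: filterS2 => t hP hQ Dt.
  by split; [exact: hP|exact: hQ].
- by rewrite /aeI => P Q PQ; apply: filterS => t hP Dt; exact/PQ/hP.
Qed.

(** A countable union of null sets is null. This allows limits and suprema of sequences in [E] to be
    treated at one fixed point [t]. *)
Lemma aeI_foralln (P : nat -> R -> Prop) :
  (forall n, aeI alpha (P n)) -> aeI alpha (fun t => forall n, P n t).
Proof.
move=> hP; have := @ae_foralln _ (measurableTypeR R) _ _ _ hP.
by apply: filterS => t hPt Dt n; exact: hPt.
Qed.

End AlmostEverywhere.

(** * Real representatives, order, norm and rotundity in [E] *)

Section BanachFunctionSpace.
Context {R : realType} {alpha : \bar R} (E : banach_function_space alpha).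
Implicit Types (x y z a : E).

(** A real-valued representative, for computing in [R]. The value 0 that [fine] gives at infinite
    values only matters on a null set, by [bfs_funE]. *)
Definition bfs_val x (t : R) : R := fine (bfs_fun E x t).

(* [0 = x - x] forces [bfs_fun E x] to be finite, because [oo - oo = -oo]. *)
Lemma bfs_funE x : aeI alpha (fun t => bfs_fun E x t = (bfs_val x t)%:E).
Proof.
have h1 := bfs_funD x (- 1 *: x); have h2 := bfs_funZ (- 1) x.
(* As [0 * oo = 0] in the extended reals, this shows that the zero vector has value 0 a.e. *)
have h3 := bfs_funZ 0 x.
move: h1 h2 h3; rewrite scaleN1r subrr scale0r => h1 h2 h3.
apply: filterS3 h1 h2 h3 => t; rewrite mul0e => -> -> h; rewrite /bfs_val.
move: h; case: (bfs_fun E x t) => [r| |] //=.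
by rewrite EFinN mulN1e.
Qed.

Lemma bfs_valD x y :
  aeI alpha (fun t => bfs_val (x + y) t = bfs_val x t + bfs_val y t).
Proof.
apply: filterS3 (bfs_funD x y) (bfs_funE x) (bfs_funE y) => t h hx hy.
by rewrite {1}/bfs_val h hx hy.
Qed.

Lemma bfs_valZ (c : R) x :
  aeI alpha (fun t => bfs_val (c *: x) t = c * bfs_val x t).
Proof.
apply: filterS2 (bfs_funZ c x) (bfs_funE x) => t h hx.
by rewrite {1}/bfs_val h hx.
Qed.

Lemma bfs_valB x y :
  aeI alpha (fun t => bfs_val (x - y) t = bfs_val x t - bfs_val y t).
Proof.
rewrite -scaleN1r; apply: filterS2 (bfs_valD x (-1 *: y)) (bfs_valZ (-1) y).
by move=> t -> ->; rewrite mulN1r.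
Qed.

Lemma bfs_val0 : aeI alpha (fun t => bfs_val 0 t = 0).
Proof.
by apply: filterS (bfs_valB 0 0) => t; rewrite subrr addrN.
Qed.

(** The ideal property only provides some [z] with the same function as [x] and norm at most that of
    [y]; injectivity on classes identifies [z] with [x]. *)
Lemma bfs_norm_le x y :
  aeI alpha (fun t => `|bfs_val x t| <= `|bfs_val y t|) -> `|x| <= `|y|.
Proof.
move=> xy; have [|z zx] := bfs_ideal (y := y) (bfs_measurable x).
  apply: filterS3 xy (bfs_funE x) (bfs_funE y) => t h -> ->.
  by rewrite lee_fin.
by have -> : z = x by exact: bfs_fun_inj.
Qed.

Definition bfs_le x y := aeI alpha (fun t => bfs_val x t <= bfs_val y t).

Lemma bfs_le_refl x : bfs_le x x.
Proof. by apply: filterS filterT. Qed.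

Lemma bfs_le_trans y x z : bfs_le x y -> bfs_le y z -> bfs_le x z.
Proof. by apply: filterS2 => t; exact: le_trans. Qed.

Lemma bfs_leD x y x' y' :
  bfs_le x y -> bfs_le x' y' -> bfs_le (x + x') (y + y').
Proof.
move=> h h'; apply: filterS2 (filterI h h')
  (filterI (bfs_valD x x') (bfs_valD y y')).
by move=> t [? ?] [-> ->]; exact: lerD.
Qed.

Lemma bfs_leB x y x' y' :
  bfs_le x y -> bfs_le x' y' -> bfs_le (x - y') (y - x').
Proof.
move=> h h'; apply: filterS2 (filterI h h')
  (filterI (bfs_valB x y') (bfs_valB y x')).
by move=> t [? ?] [-> ->]; exact: lerB.
Qed.

Lemma bfs_le_sum (I : Type) (r : seq I) (f g : I -> E) :
  (forall i, bfs_le (f i) (g i)) ->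
  bfs_le (\sum_(i <- r) f i) (\sum_(i <- r) g i).
Proof.
move=> fg; apply: big_rec2 => [|i x y _]; first exact: bfs_le_refl.
exact: bfs_leD.
Qed.

Lemma bfs_le_scale (c : R) x : 1 <= c -> bfs_le 0 x -> bfs_le x (c *: x).
Proof.
move=> c1 x0; apply: filterS3 x0 bfs_val0 (bfs_valZ c x) => t + e0 ->.
by rewrite e0 => x0; rewrite ler_peMl.
Qed.

Lemma bfs_norm_mono x y : bfs_le 0 x -> bfs_le x y -> `|x| <= `|y|.
Proof.
move=> x0 xy; apply: bfs_norm_le.
apply: filterS3 x0 xy bfs_val0 => t + h e0; rewrite e0 => x0.
by rewrite !ger0_norm// (le_trans x0).
Qed.

Lemma positive_coneE x : positive_cone x <-> bfs_le 0 x.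
Proof.
split=> x0.
  apply: filterS3 x0 (bfs_funE x) bfs_val0 => t + e ->.
  by rewrite e lee_fin.
apply: filterS3 x0 (bfs_funE x) bfs_val0 => t + e e0.
by rewrite e lee_fin e0.
Qed.

(* If [z >= a] then the negative part of [y - a] is dominated by [|y - z|]. *)
Lemma bfs_le_closed a y :
  (forall e : R, 0 < e -> exists2 z, bfs_le a z & `|y - z| < e) -> bfs_le a y.
Proof.
move=> ay; have [p hp] := bfs_min (y - a) 0.
have {}hp : aeI alpha (fun t =>
    bfs_val p t = Num.min (bfs_val y t - bfs_val a t) 0).
  apply: filterS3 (filterI hp (bfs_valB y a)) bfs_val0
    (filterI (bfs_funE (y - a)) (bfs_funE 0)) => t [h <-] <- [h1 h2].
  by rewrite {1}/bfs_val h h1 h2 -EFin_min.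
have p0 : p = 0.
  apply/eqP; rewrite -normr_le0; apply/ler_addgt0Pl => e e0.
  rewrite addr0; have [z az /ltW] := ay _ e0; apply: le_trans.
  apply: bfs_norm_le; apply: filterS3 hp az (bfs_valB y z) => t -> h ->.
  rewrite minEle; case: ifPn => [h0|_]; last by rewrite normr0.
  by rewrite !ler0_norm ?lerN2 ?lerB// (le_trans _ h0)// lerB.
move: hp; rewrite p0 => hp; apply: filterS2 hp bfs_val0 => t -> /eqP.
by rewrite eq_minr subr_ge0.
Qed.

(** Here [y] is a cluster point of the normalised sequence. Its terms of large index lie above any
    given [s m], and so does [y]; their distance to the corresponding terms of [s] tends to 0. *)
Lemma rotund_increasing_limit (k : nat) x (s : nat -> E) :
  compact_local_fully_rotund k x ->
  (forall n, bfs_le 0 (s n)) -> (forall n, bfs_le (s n) x) ->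
  (forall m n, (m <= n)%N -> bfs_le (s m) (s n)) ->
  `|s n| @[n --> \oo] --> (1 : R) ->
  exists2 y, forall m, bfs_le (s m) y &
    forall (e : R) (m : nat), 0 < e -> exists2 n, (m <= n)%N & `|y - s n| < e.
Proof.
move=> [x1 hx] s0 sx s_incr s_cvg.
have x1E : `|x| = 1 := x1.
have s_le1 n : `|s n| <= 1 by rewrite -x1E; exact: bfs_norm_mono.
(* The shift by [N] discards the terms that may vanish and cannot be normalised. *)
have [N _ sN_gt0] : \forall n \near \oo, 0 < `|s n|.
  exact: (cvgr_gt 1 s_cvg).
have {}sN_gt0 n : 0 < `|s (n + N)%N| by apply: sN_gt0; rewrite /= leq_addl.
pose w n := `|s (n + N)%N|^-1 *: s (n + N)%N.
have w1 n : `|w n| = 1.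
  by rewrite normrZ normfV normr_id mulVf// gt_eqF.
have s_le_w n : bfs_le (s (n + N)%N) (w n).
  by apply: bfs_le_scale => //; rewrite invf_ge1.
have sw_dist n : `|w n - s (n + N)%N| = 1 - `|s (n + N)%N|.
  have -> : w n - s (n + N)%N = (`|s (n + N)%N|^-1 - 1) *: s (n + N)%N.
    by rewrite scalerBl scale1r.
  rewrite normrZ ger0_norm ?subr_ge0 ?invf_ge1// mulrBl mul1r mulVf//.
  by rewrite gt_eqF.
have s_cvgN : `|s (n + N)%N| @[n --> \oo] --> (1 : R).
  by rewrite (cvg_shiftn N (fun n => `|s n|)).
have w_rotund (phi : 'I_k -> nat -> nat) :
    (forall i (n : nat), (n <= phi i n)%N) ->
    (* Squeeze: each of the [k + 1] summands dominates [s (n + N)], since [n <= phi i n], and each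
       has norm 1. *)
    `|x + \sum_(i < k) w (phi i n)| @[n --> \oo] --> (k.+1%:R : R).
  move=> hphi.
  apply: (@squeeze_cvgr _ _ _ _ (fun n => k.+1%:R * `|s (n + N)%N|)
    (fun=> k.+1%:R)).
  - apply: nearW => n; apply/andP; split.
      have -> : k.+1%:R * `|s (n + N)%N| =
          `|s (n + N)%N + \sum_(i < k) s (n + N)%N|.
        by rewrite sumr_const card_ord -mulrS normrMn mulr_natl.
      apply: bfs_norm_mono.
        rewrite -[bfs_le 0](_ : bfs_le (0 + \sum_(i < k) 0) = _); last first.
          by rewrite big1 // addr0.
        by apply: bfs_leD => //; apply: bfs_le_sum.
      apply: bfs_leD => //; apply: bfs_le_sum => i.
      by apply: bfs_le_trans (s_le_w _); apply: s_incr; rewrite leq_add2r.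
    apply: le_trans (ler_normD _ _) _; rewrite x1E -natr1 addrC lerD2r.
    apply: le_trans (ler_norm_sum _ _ _) _.
    by under eq_bigr do rewrite w1; rewrite sumr_const card_ord.
  - by rewrite -[X in _ --> X]mulr1; exact: cvgZl_tmp.
  - exact: cvg_cst.
have : precompact (range w).
  apply: hx => // phi hphi; apply: w_rotund => i.
  elim=> // n IH; apply: leq_ltn_trans IH _.
  (* [increasing_seq] says that [phi i] preserves and reflects [<=], so strict growth comes from the
     failure of [n.+1 <= n]. *)
  by rewrite ltnNge -[leq _ _]/((phi i n.+1 <= phi i n)%O) hphi ltnn.
(* The closure of the range is compact, so the image under [w] of the filter at infinity clusters at
   some [y]. *)
rewrite precompactE => /(_ (w @ \oo)) [|y [_ y_clus]].
  by exists 0%N => // n _; apply: subset_closure; exists n.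
have wy (e : R) (m : nat) : 0 < e -> exists2 n, (m <= n)%N & `|y - w n| < e.
  move=> e0; have [|_ [[n /= mn <-] yw]] :=
    y_clus (w @` [set n | (m <= n)%N]) (ball y e) _ (nbhsx_ballx _ _ e0).
    by exists m => // n /= mn; exists n.
  by exists n => //; move: yw; rewrite -ball_normE.
exists y.
  move=> m; apply: bfs_le_closed => e e0.
  have [n mn yw] := wy e m e0; exists (w n) => //.
  apply: bfs_le_trans (s_le_w _); apply: s_incr.
  exact: leq_trans (leq_addr _ _).
(* One half of [e] bounds the distance from [y] to [w n], the other the distance [1 - |s (n + N)|]
   from [w n] to [s (n + N)]. *)
move=> e m e0; have e2 : 0 < e / 2 by rewrite divr_gt0.
have [M _ hM] : \forall n \near \oo, 1 - e / 2 < `|s (n + N)%N|.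
  by apply: (cvgr_gt 1 s_cvgN); rewrite ltrBlDr ltrDl.
have [n] := wy _ (maxn m M) e2; rewrite geq_max => /andP[mn Mn] yw.
exists (n + N)%N; first exact: leq_trans (leq_addr _ _).
have := hM n Mn; have := ler_distD (w n) y (s (n + N)%N).
by rewrite sw_dist; lra.
Qed.

(** The tail suprema are measurable and lie a.e. between 0 and [|x|], so the ideal property realises
    them in [E]. *)
Lemma bfs_tail_sup x (u : nat -> E) :
  (forall n, positive_cone (u n)) ->
  (forall n, aeI alpha (fun t => (bfs_fun E (u n) t <= `|bfs_fun E x t|)%E)) ->
  exists v : nat -> E, forall n,
    aeI alpha (fun t =>
      bfs_fun E (v n) t = esups (fun m => bfs_fun E (u m) t) n).
Proof.
move=> u0 ux.
suff /choice[v hv] : forall n, exists z, aeI alpha (fun t =>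
    bfs_fun E z t = esups (fun m => bfs_fun E (u m) t) n) by exists v.
move=> n; have [||z hz _] := @bfs_ideal _ _ E
  (fun t => esups (fun m => bfs_fun E (u m) t) n) x; last by exists z.
- apply: (@measurable_fun_esups _ (measurableTypeR R) R (domI alpha)
    (fun m => bfs_fun E (u m))) => m.
  exact: bfs_measurable.
apply: filterS2 (aeI_foralln u0) (aeI_foralln ux) => t h0 h1.
rewrite gee0_abs; last first.
  by apply: le_trans (h0 n) _; apply: ereal_sup_ubound; exists n => /=.
by apply: ge_ereal_sup => _ [m _ <-].
Qed.

End BanachFunctionSpace.

Theorem proposition4p3 (R : realType) (alpha : \bar R)
    (halpha : alpha = 1%:E \/ alpha = +oo%E)
    (E : banach_function_space alpha) (hE : semi_Fatou E)
    (k : nat) (hk : (2 <= k)%N)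
    (x : E) (hx0 : positive_cone x)
    (hx : compact_local_fully_rotund k x) :
  order_continuity_point x.
Proof.
move=> u u0 ux ucvg.
have [v hv] := bfs_tail_sup u0 ux.
have ae_v : aeI alpha (fun t => forall n,
    (bfs_val (v n) t)%:E = esups (fun m => bfs_fun E (u m) t) n).
  apply: aeI_foralln => n.
  by apply: filterS2 (hv n) (bfs_funE (v n)) => t -> <-.
have x0 : bfs_le 0 x by exact/positive_coneE.
have uv n : bfs_le (u n) (v n).
  apply: filterS2 ae_v (bfs_funE (u n)) => t vE uE.
  by rewrite -lee_fin vE -uE; apply: ereal_sup_ubound; exists n => /=.
have v0 n : bfs_le 0 (v n).
  by apply: bfs_le_trans (uv n); exact/positive_coneE.
have vx n : bfs_le (v n) x.
  apply: filterS3 (filterI ae_v (bfs_val0 E)) (filterI x0 (bfs_funE x))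
    (aeI_foralln ux) => t [vE e0] [+ xE] h; rewrite e0 => xt0.
  rewrite -lee_fin vE; apply: ge_ereal_sup => _ [m _ <-].
  by apply: le_trans (h m) _; rewrite xE gee0_abs.
have v_decr m n : (m <= n)%N -> bfs_le (v n) (v m).
  move=> mn; apply: filterS ae_v => t vE.
  by rewrite -lee_fin !vE; exact: nonincreasing_esups.
(* The tail suprema of a convergent sequence have the same limit. *)
have v_cvg : aeI alpha (fun t => bfs_val (v n) t @[n --> \oo] --> (0 : R)).
  apply: filterS2 ae_v ucvg => t vE /cvg_esups.
  rewrite (_ : esups _ = fun n => (bfs_val (v n) t)%:E); last first.
    by apply/funext => n; rewrite vE.
  by move/fine_cvgP => [].
pose s n := x - v n.
have s0 n : bfs_le 0 (s n).
  by rewrite -(subrr (v n)); apply: bfs_leB => //; exact: bfs_le_refl.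
have sx n : bfs_le (s n) x.
  by rewrite -[X in bfs_le _ X]subr0; apply: bfs_leB => //; exact: bfs_le_refl.
have s_incr m n : (m <= n)%N -> bfs_le (s m) (s n).
  by move=> mn; apply: bfs_leB; [exact: bfs_le_refl | exact: v_decr].
have s_val : aeI alpha (fun t => forall n,
    bfs_val (s n) t = bfs_val x t - bfs_val (v n) t).
  by apply: aeI_foralln => n; exact: bfs_valB.
have [_] : nondecreasing_seq (fun n => `|s n|) /\
    (`|s n| @[n --> \oo] --> `|x|).
  apply: hE => //.
  - by move=> n; exact/positive_coneE.
  - split=> [n|].
      apply: filterS3 (s_incr n n.+1 (leqnSn n)) (bfs_funE (s n))
        (bfs_funE (s n.+1)) => t h -> ->.
      by rewrite lee_fin.
    apply: filterS3 (filterI v_cvg s_val) (bfs_funE x)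
      (aeI_foralln (fun n => bfs_funE (s n))) => t [vt0 sE] -> sF.
    under eq_fun do rewrite sF sE.
    apply: cvg_EFin; first exact: nearW.
    by rewrite -[X in _ --> X]subr0; apply: cvgB vt0; exact: cvg_cst.
have [x1 _] := hx; rewrite [`|x|]x1 => s_cvg.
have [y sy y_lim] := rotund_increasing_limit hx s0 sx s_incr s_cvg.
(* At almost every [t] all the inequalities [s n <= y] hold, and [s n] tends to [x]. *)
have xy : bfs_le x y.
  apply: filterS3 v_cvg s_val (aeI_foralln sy) => t vt0 sE h.
  have /cvgr_to_le : bfs_val x t - bfs_val (v n) t @[n --> \oo] -->
      bfs_val x t.
    by rewrite -[X in _ --> X]subr0; apply: cvgB vt0; exact: cvg_cst.
  by apply; apply: nearW => n; rewrite -sE.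
(* A single [n] suffices: for [m >= n], [u m <= v m <= v n = x - s n <= y - s n]. *)
apply/cvgrPdist_lt => e e0; have [n _ yn] := y_lim e 0%N e0.
exists n => // m /= nm; rewrite sub0r normrN normr_id.
apply: le_lt_trans yn; apply: bfs_norm_mono; first exact/positive_coneE.
apply: bfs_le_trans (uv m) _; apply: bfs_le_trans (v_decr _ _ nm) _.
by rewrite -[v n](subKr x); apply: bfs_leB => //; exact: bfs_le_refl.
Qed.
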